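(* Let $m$ be a positive integer. Assume that $g:\mathbb R\to\mathbb R^m$ is an unpredictable function and that $f:\mathbb R\to\mathbb R^m$ is continuous and periodic. Then the sum $g+f$ is an unpredictable function.
   Context: $\|\cdot\|$ denotes the Euclidean norm for vectors. A uniformly continuous and bounded function $\vartheta:\mathbb R\to\mathbb R^m$ is called unpredictable if there exist positive numbers $\epsilon_0,\delta$ and sequences $\{t_n\},\{u_n\}$ of real numbers, both of which diverge to infinity, such that (i) $\|\vartheta(t+t_n)-\vartheta(t)\|\to 0$ as $n\to\infty$ uniformly on compact subsets of $\mathbb R$, and (ii) $\|\vartheta(t+t_n)-\vartheta(t)\|\ge\epsilon_0$ for each $t\in[u_n-\delta,u_n+\delta]$ and each $n\in\mathbb N$. *)

(* Defs.v *)
From HB Require Import structures.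
From mathcomp Require Import all_boot all_order all_algebra.
From mathcomp Require Import all_classical all_reals all_analysis.

Set Implicit Arguments.
Unset Strict Implicit.
Unset Printing Implicit Defensive.

Import Order.TTheory GRing.Theory Num.Theory.
Import numFieldNormedType.Exports.
Local Open Scope classical_set_scope.
Local Open Scope ring_scope.

(* The library norm on row vectors is the sup norm, so every quantitative
   condition below goes through [enorm]; the library topology and uniform
   structure on row vectors agree with the Euclidean ones. *)
Definition enorm (R : realType) (m : nat) (v : 'rV[R]_m) : R :=
  Num.sqrt (\sum_(i < m) v ord0 i ^+ 2).

Definition unpredictable (R : realType) (m : nat) (theta : R -> 'rV[R]_m) : Prop :=
  [/\ unif_continuous theta,
      [bounded enorm (theta t) | t in [set: R]] &
      exists (eps0 delta : R) (t_ u_ : nat -> R),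
        [/\ (0 < eps0) /\ (0 < delta),
            t_ @ \oo --> +oo,
            u_ @ \oo --> +oo,
            (forall K : set R, compact K ->
               {uniform K, (fun n t => enorm (theta (t + t_ n) - theta t)) @ \oo
                             --> (fun=> 0 : R)}) &
            forall (n : nat) (t : R), u_ n - delta <= t <= u_ n + delta ->
              eps0 <= enorm (theta (t + t_ n) - theta t)]].

(* Main.v *)
Require Import Defs.
From mathcomp Require Import all_boot all_order all_algebra.
From mathcomp Require Import all_classical all_reals all_analysis.
From mathcomp Require Import ring lra.
Import Order.TTheory GRing.Theory Num.Theory.
Import numFieldNormedType.Exports.
Local Open Scope classical_set_scope.
Local Open Scope ring_scope.

(** The sequence [t_] witnessing that [g] is unpredictable need not nearly
    preserve [f]: its terms may stay away from the multiples of the period [w].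
    It has to be replaced by shifts [s] that are close to multiples of [w] and
    along which [g] still returns near itself on compact sets, yet moves by a
    definite amount somewhere.

    Modulo [w] the sequence [t_] has a cluster point [a].  Sums of terms of
    [t_], each chosen far enough after the previous ones, are again near-return
    times of [g], so near-return times realize every multiple [j * a], [j >= 0],
    modulo [w] up to a small error ([return_multiple]).  Two multiples of [a]
    nearly agree modulo [w]; their difference, less one [a], shows that [-a] is
    realized by some [r] as well ([return_opposite]).  For infinitely many [n]
    the shift [s = r + t_ n] is then nearly a multiple of [w].

    Some of these shifts move [g] by more than a third of the amount [e0] by
    which every [t_ n] does ([separation_shift]).  Otherwise [g] would be
    uniformly close to its shift by [r + t_ n] for all suitable [n]; recurrence,
    as [n] tends to infinity, makes [g] uniformly close to its shift by [r],
    hence to its shift by [t_ n], which contradicts the separation.  A last use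
    of recurrence moves the point of separation arbitrarily far to the right
    ([common_return]), and uniform continuity of [g] widens it to an interval of
    constant length.  Because [f] is almost unchanged by [s], the same shifts
    and intervals serve for [g + f].

    The estimates are carried out in an arbitrary normed module and transferred
    to the Euclidean norm, which is equivalent to the sup norm on row vectors. *)

(** * Continuous periodic functions *)

Lemma periodic_mulz (R : realType) (V : zmodType) (f : R -> V) (w : R) :
  periodic f w -> forall (k : int) t, f (t + k%:~R * w) = f t.
Proof.
move=> fw; have fn (n : nat) t : f (t + n%:R * w) = f t.
  by rewrite mulr_natl periodicn.
case=> n t; first exact: fn.
by rewrite NegzE -[in RHS](subrK (n.+1%:R * w) t) fn mulrNz mulNr.
Qed.

(** Bolzano-Weierstrass on the circle of length [w]: the representatives of
    the [x n] in [[0, w]] have a cluster point. *)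
Lemma cluster_mod (R : realType) (w : R) (x : nat -> R) : 0 < w ->
  exists a : R, forall (e : R) (N : nat), 0 < e ->
    exists n (k : int), (N <= n)%N /\ `|x n - (a + k%:~R * w)| < e.
Proof.
move=> w0; pose y n := x n - (Num.floor (x n / w))%:~R * w.
have ybnd n : y n \in `[0, w].
  have /andP[lo hi] := floor_itv (x n / w).
  move: lo hi; rewrite ler_pdivlMr// ltr_pdivrMr// intrD mulrDl mul1r => lo hi.
  by rewrite in_itv /=; apply/andP; split; rewrite /y; lra.
have yF : (y @ \oo) `[0, w]%classic by exists 0%N => // n _; exact: ybnd.
have [a [_ cl]] := segment_compact _ yF.
exists a => e N e0.
have e20 : 0 < e / 2 by rewrite divr_gt0.
have /cluster_eventuallyP /(_ (e / 2) N e20) [n Nn yn] := cl.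
exists n, (Num.floor (x n / w)); split => //.
rewrite distrC in yn; rewrite opprD addrCA addrC -addrA addrC.
apply: (le_lt_trans _ (_ : e / 2 < e)); last lra.
by move: yn; rewrite /y; congr (`|_| <= _); ring.
Qed.

Lemma continuous_near (R : realType) (V : normedModType R) (f : R -> V) (a e : R) :
  continuous f -> 0 < e ->
  exists2 d : R, 0 < d & forall x, `|x - a| < d -> `|f x - f a| < e.
Proof.
move=> fc e0.
have /nbhs_ballP[d /= d0 fd] : \forall x \near a, `|f x - f a| < e.
  exact: (@cvgr_distC_lt _ _ _ _ _ _ _ (fc a)) e0.
by exists d => // x xd; apply: fd; rewrite /ball/= distrC.
Qed.

(** Along points where [f] has unbounded norm, a cluster point modulo the
    period would contradict local boundedness of [f] there. *)
Lemma continuous_periodic_bounded (R : realType) (V : normedModType R)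
    (f : R -> V) (w : R) : continuous f -> 0 < w -> periodic f w ->
  exists M : R, forall t, `|f t| <= M.
Proof.
move=> fc w0 fw; apply: contrapT => unb.
have /choice[x xP] : forall n : nat, exists t, n%:R < `|f t|.
  move=> n; apply: contrapT => nx; apply: unb; exists n%:R => t.
  by rewrite leNgt; apply/negP => ft; apply: nx; exists t.
have [a aP] := cluster_mod _ w x w0.
have [d d0 fd] := continuous_near _ _ f a 1 fc ltr01.
have M0 : 0 <= 1 + `|f a| by rewrite addr_ge0.
have [n [k [Nn xn]]] := aP d (Num.bound (1 + `|f a|)) d0.
have := fd (x n - k%:~R * w).
rewrite (_ : x n - k%:~R * w - a = x n - (a + k%:~R * w)); last by ring.
move=> /(_ xn).
rewrite -(periodic_mulz _ _ _ _ fw k) subrK => fxa.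
have := xP n; have := ler_normD (f (x n) - f a) (f a); rewrite subrK.
have := archi_boundP M0; have : (Num.bound (1 + `|f a|))%:R <= n%:R :> R.
  by rewrite ler_nat.
by move: fxa; lra.
Qed.

(** Pairs of points that violate uniform continuity at ever smaller distances
    would cluster, modulo the period, at a single point, where [f] is
    continuous. *)
Lemma continuous_periodic_unif (R : realType) (V : normedModType R)
    (f : R -> V) (w : R) : continuous f -> 0 < w -> periodic f w ->
  forall e : R, 0 < e ->
  exists2 d : R, 0 < d & forall x y, `|x - y| < d -> `|f x - f y| < e.
Proof.
move=> fc w0 fw e e0; apply: contrapT => nuc.
have /choice[p pP] : forall n : nat, exists p : R * R,
    `|p.1 - p.2| < n.+1%:R^-1 /\ e <= `|f p.1 - f p.2|.
  move=> n; apply: contrapT => np; apply: nuc; exists n.+1%:R^-1.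
    by rewrite invr_gt0 ltr0n.
  move=> x y xy; rewrite ltNge; apply/negP => fxy.
  by apply: np; exists (x, y).
have [a aP] := cluster_mod _ w (fun n => (p n).1) w0.
have e20 : 0 < e / 2 by rewrite divr_gt0.
have [d d0 fd] := continuous_near _ _ f a _ fc e20.
have d20 : 0 < d / 2 by rewrite divr_gt0.
have [N _ NP] := near_infty_natSinv_lt (PosNum d20).
have [n [k [Nn xn]]] := aP _ N d20.
have [pn fpn] := pP n.
have {}pn := lt_trans pn (NP _ Nn); rewrite /= in pn.
set x := (p n).1 in xn pn fpn; set y := (p n).2 in pn fpn.
have fxa : `|f x - f a| < e / 2.
  rewrite -(periodic_mulz _ _ _ _ fw (- k) x); apply: fd.
  rewrite (_ : _ - a = x - (a + k%:~R * w)); first lra.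
  by rewrite mulrNz; ring.
have fya : `|f y - f a| < e / 2.
  rewrite -(periodic_mulz _ _ _ _ fw (- k) y); apply: fd.
  rewrite (_ : _ - a = (y - x) + (x - (a + k%:~R * w))); last first.
    by rewrite mulrNz; ring.
  by apply: (le_lt_trans (ler_normD _ _)); rewrite distrC; lra.
have := ler_distD (f a) (f x) (f y).
by rewrite [`|f a - f y|]distrC; lra.
Qed.

(** * Near-return times of a recurrent function *)

Section returns.
Variables (R : realType) (V : normedModType R) (g : R -> V) (t_ : nat -> R).
Hypothesis g_rec : forall L e : R, 0 < e ->
  exists N : nat, forall n, (N <= n)%N -> forall t, `|t| <= L ->
    `|g (t + t_ n) - g t| < e.

(** Near-return times can be composed: if [r] is one on [[-L, L]], then so is
    [r + t_ n] once [n] is large enough for [t_ n] to be one on the larger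
    interval that contains [t + r] for all [t] in [[-L, L]]. *)
Lemma return_multiple (w a : R) :
  (forall (e : R) (N : nat), 0 < e ->
    exists n (k : int), (N <= n)%N /\ `|t_ n - (a + k%:~R * w)| < e) ->
  forall (j : nat) (L e : R), 0 < e -> exists (r : R) (k : int),
    (forall t, `|t| <= L -> `|g (t + r) - g t| < e) /\
    `|r - (j%:R * a + k%:~R * w)| < e.
Proof.
move=> aP; elim=> [|j IH] L e e0.
  exists 0, 0; split=> [t _|]; first by rewrite addr0 subrr normr0.
  by rewrite !mul0r addr0 subrr normr0.
have e20 : 0 < e / 2 by rewrite divr_gt0.
have [r [k [gr rk]]] := IH L _ e20.
have [N NP] := g_rec (L + `|r|) _ e20.
have [n [l [Nn tl]]] := aP _ N e20.
exists (r + t_ n), (k + l); split=> [t tL|].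
  have trL : `|t + r| <= L + `|r| by apply: (le_trans (ler_normD _ _)); lra.
  have := NP _ Nn _ trL; have := gr _ tL.
  have := ler_distD (g (t + r)) (g (t + r + t_ n)) (g t).
  by rewrite addrA; lra.
rewrite (_ : _ - _ = (r - (j%:R * a + k%:~R * w)) +
    (t_ n - (a + l%:~R * w))); last by rewrite intrD -natr1; ring.
by apply: (le_lt_trans (ler_normD _ _)); lra.
Qed.

(** The multiples of [a] cluster modulo [w], so [i * a] and [j * a] nearly agree
    for some [i < j]; then [(j - i - 1) * a] is nearly [-a]. *)
Lemma return_opposite (w a : R) : 0 < w ->
  (forall (e : R) (N : nat), 0 < e ->
    exists n (k : int), (N <= n)%N /\ `|t_ n - (a + k%:~R * w)| < e) ->
  forall L e : R, 0 < e -> exists (r : R) (k : int),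
    (forall t, `|t| <= L -> `|g (t + r) - g t| < e) /\
    `|r + a - k%:~R * w| < e.
Proof.
move=> w0 aP L e e0.
have [b bP] := cluster_mod _ w (fun j => j%:R * a) w0.
have e40 : 0 < e / 4 by rewrite divr_gt0.
have [i [k [_ ik]]] := bP _ 0%N e40.
have [j [l [ij jl]]] := bP _ i.+1 e40.
have e20 : 0 < e / 2 by rewrite divr_gt0.
have [r [h [gr rh]]] := return_multiple w a aP (j - i.+1)%N L _ e20.
exists r, (h + l - k); split=> [t tL|].
  by apply: lt_trans (gr _ tL) _; lra.
rewrite natrB// -natr1 in rh.
rewrite (_ : _ - _ = (r - ((j%:R - (i%:R + 1)) * a + h%:~R * w)) +
    ((j%:R * a - (b + l%:~R * w)) - (i%:R * a - (b + k%:~R * w)))); last first.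
  by rewrite !rmorphD/= rmorphN/=; ring.
apply: (le_lt_trans (ler_normD _ _)).
have := ler_normB (j%:R * a - (b + l%:~R * w)) (i%:R * a - (b + k%:~R * w)).
lra.
Qed.

(** If [g] moved by at most [e0 / 3] under all the shifts [r + t_ n] with
    [P n], letting such [n] tend to infinity would bound its motion under [r] by
    essentially [e0 / 3], and its motion under a single [t_ n] by essentially
    [2 * e0 / 3]. *)
Lemma separation_shift (e0 : R) (P : nat -> Prop) (r : R) :
  0 < e0 ->
  (forall n, exists u, e0 <= `|g (u + t_ n) - g u|) ->
  (forall N : nat, exists2 n, (N <= n)%N & P n) ->
  exists2 n, P n & exists u, e0 / 3 < `|g (u + (r + t_ n)) - g u|.
Proof.
move=> e00 sep Pinf; apply: contrapT => nfar.
have near n : P n -> forall u, `|g (u + (r + t_ n)) - g u| <= e0 / 3.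
  move=> Pn u; rewrite leNgt; apply/negP => far.
  by apply: nfar; exists n => //; exists u.
have e90 : 0 < e0 / 9 by rewrite divr_gt0.
have rnear u : `|g (u + r) - g u| <= e0 * (4 / 9).
  have [N NP] := g_rec `|u + r| _ e90.
  have [n Nn Pn] := Pinf N.
  have := NP _ Nn _ (lexx _); have := near _ Pn u; rewrite addrA.
  have := ler_distD (g (u + r + t_ n)) (g (u + r)) (g u).
  by rewrite [`|g (u + r) - g (u + r + _)|]distrC; lra.
have [n _ Pn] := Pinf 0%N.
have [u sepu] := sep n.
have := near _ Pn (u - r); have := rnear (u - r).
rewrite addrA subrK.
have := ler_distD (g (u - r)) (g (u + t_ n)) (g u).
by rewrite [`|g u - g (u - r)|]distrC; lra.
Qed.

(** The third of [e0] provided by [separation_shift] drops to a quarter because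
    the point of separation is carried to the right by a near-return time [t_ q]
    at the cost of two errors [e0 / 24]. *)
Lemma common_return (e0 : R) (f : R -> V) (w : R) :
  0 < e0 ->
  (forall n, exists u, e0 <= `|g (u + t_ n) - g u|) ->
  t_ @ \oo --> +oo ->
  continuous f -> 0 < w -> periodic f w ->
  forall L e : R, 0 < e -> exists s u : R, [/\ L < s, L < u,
    forall t, `|t| <= L -> `|g (t + s) - g t| < e,
    forall t, `|f (t + s) - f t| < e &
    e0 / 4 < `|g (u + s) - g u| ].
Proof.
move=> e00 sep t_oo fc w0 fw L e e_gt0.
have [a aP] := cluster_mod _ w t_ w0.
have [d d0 fd] := continuous_periodic_unif _ _ f w fc w0 fw e e_gt0.
have e2 : 0 < Num.min (e / 2) (d / 2) by rewrite lt_min; apply/andP; split; lra.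
have [r [k [gr rk]]] := return_opposite w a w0 aP L _ e2.
have [N1 N1P] := g_rec (L + `|r|) (e / 2) ltac:(lra).
move/cvgryPgt: (t_oo) => t_gt.
have [N2 _ N2P] := t_gt (L - r).
pose P n := [/\ (N1 <= n)%N, (N2 <= n)%N &
  exists l : int, `|t_ n - (a + l%:~R * w)| < d / 2].
have Pinf (N : nat) : exists2 n, (N <= n)%N & P n.
  have [n [l [Nn tl]]] := aP (d / 2) (maxn N (maxn N1 N2)) ltac:(lra).
  move: Nn; rewrite !geq_max => /and3P[Nn N1n N2n].
  by exists n => //; split => //; exists l.
have [n [N1n N2n [l tl]] [u far]] := separation_shift e0 P r e00 sep Pinf.
pose s := r + t_ n.
have e240 : 0 < e0 / 24 by lra.
have [N3 N3P] := g_rec (`|u| + `|s|) _ e240.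
have [N4 _ N4P] := t_gt (L - u).
pose q := maxn N3 N4.
have gu : `|g (u + t_ q) - g u| < e0 / 24.
  by apply: N3P; rewrite ?leq_maxl// lerDl.
have gus : `|g (u + s + t_ q) - g (u + s)| < e0 / 24.
  by apply: N3P; rewrite ?leq_maxl// ler_normD.
exists s, (u + t_ q); split.
- by have := N2P _ N2n; rewrite /s /=; lra.
- by have := N4P _ (leq_maxr N3 N4); rewrite /= -/q; lra.
- move=> t tL; have trL : `|t + r| <= L + `|r|.
    by apply: (le_trans (ler_normD _ _)); lra.
  have := N1P _ N1n _ trL; have := gr _ tL; rewrite lt_min => /andP[+ _].
  have := ler_distD (g (t + r)) (g (t + r + t_ n)) (g t).
  by rewrite /s addrA; lra.
- move=> t; rewrite -(periodic_mulz _ _ _ _ fw (- (k + l)) (t + s)).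
  apply: fd; move: rk; rewrite lt_min => /andP[_ rk].
  rewrite (_ : _ - t = (r + a - k%:~R * w) + (t_ n - (a + l%:~R * w))).
    by apply: (le_lt_trans (ler_normD _ _)); lra.
  by rewrite /s mulrNz intrD; ring.
- have := ler_distD (g (u + s + t_ q)) (g (u + s)) (g u).
  have := ler_distD (g (u + t_ q)) (g (u + s + t_ q)) (g u).
  rewrite [`|g (u + s) - g (u + s + t_ q)|]distrC.
  rewrite (_ : u + t_ q + s = u + s + t_ q); last by ring.
  by move: far; rewrite -/s; lra.
Qed.

End returns.

(** * Euclidean norm and uniform convergence *)

Lemma coord_le_norm (R : realType) (m : nat) (v : 'rV[R]_m) (i : 'I_m) :
  `|v ord0 i| <= `|v|.
Proof.
rewrite [leRHS]/Num.norm /= mx_normrE.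
exact: (le_bigmax_cond 0 (fun ij : 'I_1 * 'I_m => `|v ij.1 ij.2|)
  (j := (ord0, i))).
Qed.

Lemma norm_le_enorm (R : realType) (m : nat) (v : 'rV[R]_m) : `|v| <= enorm v.
Proof.
rewrite [leLHS]/Num.norm /= mx_normrE; apply: bigmax_le; first exact: sqrtr_ge0.
move=> [i j] _ /=; rewrite (ord1 i) -sqrtr_sqr ler_wsqrtr//.
by rewrite (bigD1 j)//= lerDl sumr_ge0// => k _; exact: sqr_ge0.
Qed.

Lemma enorm_le_norm (R : realType) (m : nat) (v : 'rV[R]_m) :
  enorm v <= Num.sqrt m%:R * `|v|.
Proof.
rewrite -[X in _ * X]ger0_norm// -sqrtr_sqr -sqrtrM// ler_wsqrtr//.
rewrite mulr_natl -[X in _ *+ X]card_ord -sumr_const; apply: ler_sum => i _.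
rewrite -real_normK ?num_real// lerXn2r ?nnegrE//; exact: coord_le_norm.
Qed.

Lemma uniform_cvg0P (R : realType) (K : set R) (h : nat -> R -> R) :
  {uniform K, h @ \oo --> (fun=> 0 : R)} <->
  forall e : R, 0 < e -> exists N : nat, forall n, (N <= n)%N ->
    forall t, K t -> `|h n t| < e.
Proof.
split=> [hK e e0|hK U /uniform_nbhs[E [entE EU]]].
- have [|N _ NP] := hK [set k | forall t, K t -> `|k t| < e]; last by exists N.
  apply/uniform_nbhs; exists [set xy | ball xy.1 e xy.2]; split.
    exact: (entourage_ball _ (PosNum e0)).
  by move=> k hP t Kt; have := hP t Kt; rewrite /= -ball_normE/= sub0r normrN.
- move: entE; rewrite -entourage_ballE => -[e /= e0 eE].
  have [N NP] := hK e e0; exists N => // n Nn; apply: EU => t Kt.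
  by apply: eE; rewrite /= -ball_normE/= sub0r normrN; exact: NP.
Qed.

(** * The sum of an unpredictable and a periodic function *)

Theorem lemma1p2 (R : realType) (m : nat) (m_gt0 : (0 < m)%N)
    (g f : R -> 'rV[R]_m) :
  unpredictable g ->
  continuous f ->
  (exists omega : R, 0 < omega /\ periodic f omega) ->
  unpredictable (fun t => g t + f t).
Proof.
move=> [g_unif g_bnd [eps0 [delta [t_ [u_
  [[eps00 delta0] t_oo u_oo g_rec g_sep]]]]]].
move=> f_cont [w [w0 f_per]].
have C0 : 0 < Num.sqrt m%:R :> R by rewrite sqrtr_gt0 ltr0n.
set C := Num.sqrt m%:R in C0.
have guc e : 0 < e -> exists2 d, 0 < d &
    forall x y, `|x - y| < d -> `|g x - g y| < e.
  move=> e0; have /unif_continuousP /(_ e e0) [d d0 gd] := g_unif.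
  exists d => // x y xy; have := gd (x, y); rewrite /= -!ball_normE; exact.
have fuc := continuous_periodic_unif _ _ f w f_cont w0 f_per.
split.
- apply/unif_continuousP => e e0.
  have e20 : 0 < e / 2 by rewrite divr_gt0.
  have [d1 d10 gd] := guc _ e20; have [d2 d20 fd] := fuc _ e20.
  exists (Num.min d1 d2); first by rewrite lt_min d10.
  move=> [x y]; rewrite -!ball_normE /= lt_min => /andP[xy1 xy2].
  rewrite opprD addrACA; apply: (le_lt_trans (ler_normD _ _)).
  by have := gd _ _ xy1; have := fd _ _ xy2; lra.
- have [M fM] := continuous_periodic_bounded _ _ f w f_cont w0 f_per.
  have PT : ProperFilter (globally [set: R]).
    exact: (globally_properfilter (a := 0)).
  have /ex_bound[G gG] := g_bnd.
  apply/ex_bound; exists (C * (G + M)) => t _ /=.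
  rewrite ger0_norm ?sqrtr_ge0//.
  apply: (le_trans (enorm_le_norm _ _ _)).
  rewrite ler_pM2l//; apply: (le_trans (ler_normD _ _)).
  apply: lerD => //.
  apply: (le_trans (norm_le_enorm _ _ _)); have := gG t I.
  by rewrite /= ger0_norm ?sqrtr_ge0.
have rec (L e : R) : 0 < e -> exists N, forall n, (N <= n)%N ->
    forall t, `|t| <= L -> `|g (t + t_ n) - g t| < e.
  move=> e0; have KL : compact `[- L, L]%classic by exact: segment_compact.
  have [N NP] := (uniform_cvg0P _ _ _).1 (g_rec _ KL) e e0.
  exists N => n Nn t tL; apply: (le_lt_trans (norm_le_enorm _ _ _)).
  by apply: le_lt_trans (ler_norm _) (NP n Nn t _); rewrite /= in_itv/= -ler_norml.
(* Dividing by the norm comparison constant turns Euclidean separation into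
   separation for the sup norm. *)
have sep n : exists u, eps0 / C <= `|g (u + t_ n) - g u|.
  exists (u_ n); rewrite ler_pdivrMr// mulrC.
  apply: le_trans (enorm_le_norm _ _ _); apply: g_sep.
  by apply/andP; split; lra.
set e1 := eps0 / C in sep.
have e10 : 0 < e1 by rewrite divr_gt0.
(* [g + f] is separated by [e1 / 8 = e1 / 4 - 3 * (e1 / 24)]: two errors come
   from moving [g] within the interval, one from the motion of [f]. *)
have e240 : 0 < e1 / 24 by rewrite divr_gt0.
have [d d0 gd] := guc _ e240.
have /choice[p pP] : forall n : nat, exists p : R * R,
  [/\ n%:R < p.1, n%:R < p.2,
   forall t, `|t| <= n%:R -> `|g (t + p.1) - g t| < n.+1%:R^-1,
   forall t, `|f (t + p.1) - f t| < Num.min n.+1%:R^-1 (e1 / 24) &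
   e1 / 4 < `|g (p.2 + p.1) - g p.2| ].
  move=> n; have e0 : 0 < Num.min n.+1%:R^-1 (e1 / 24).
    by rewrite lt_min e240 invr_gt0 ltr0n.
  have [s [u [sn un gs fs us]]] := common_return _ _ g t_ rec e1 f w e10 sep t_oo
    f_cont w0 f_per n%:R _ e0.
  exists (s, u); split => // t tn.
  by have := gs t tn; rewrite lt_min => /andP[].
have oo (x : nat -> R) : (forall n, n%:R < x n) -> x @ \oo --> +oo.
  move=> xn; apply/cvgryPgt => A; exists (Num.bound `|A|) => // n /= An.
  apply: (le_lt_trans (ler_norm A)).
  apply: (lt_trans (archi_boundP (normr_ge0 A))).
  by apply: (le_lt_trans _ (xn n)); rewrite ler_nat.
exists (e1 / 8), (d / 2), (fun n => (p n).1), (fun n => (p n).2); split.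
- by split; rewrite divr_gt0.
- by apply: oo => n; have [] := pP n.
- by apply: oo => n; have [] := pP n.
- move=> K /compact_bounded[B0 [_ KB0]]; set B := B0 + 1.
  have KB t : K t -> `|t| <= B by apply: KB0; rewrite ltrDl.
  apply/uniform_cvg0P => e e0.
  have e2C : 0 < e / (2 * C) by rewrite divr_gt0// mulr_gt0.
  have [N _ NP] := near_infty_natSinv_lt (PosNum e2C).
  exists (maxn N (Num.bound `|B|)) => // n /=; rewrite geq_max => /andP[Nn Bn].
  move=> t Kt; rewrite ger0_norm ?sqrtr_ge0//.
  apply: (le_lt_trans (enorm_le_norm _ _ _)).
  have [_ _ gs fs _] := pP n.
  have tn : `|t| <= n%:R.
    apply: (le_trans (KB t Kt)); apply: (le_trans (ler_norm B)).
    apply: (le_trans (ltW (archi_boundP (normr_ge0 B)))).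
    by rewrite ler_nat.
  have := gs t tn; have := fs t; rewrite lt_min => /andP[ft _] gt.
  have := NP n Nn; rewrite /= => nC.
  rewrite opprD addrACA.
  have sumlt : `|g (t + (p n).1) - g t + (f (t + (p n).1) - f t)| < e / C.
    apply: (le_lt_trans (ler_normD _ _)).
    have -> : e / C = e / (2 * C) + e / (2 * C).
      by field; rewrite gt_eqF.
    by apply: ltrD; [exact: lt_trans gt nC|exact: lt_trans ft nC].
  by rewrite mulrC -ltr_pdivlMr.
- move=> n t /andP[t1 t2]; apply: le_trans (norm_le_enorm _ _ _).
  have [_ _ _ fs us] := pP n.
  have := fs t; rewrite lt_min => /andP[_ ft].
  set s := (p n).1 in us ft *; set u := (p n).2 in us t1 t2.
  have ut : `|u - t| < d by rewrite ltr_norml; apply/andP; split; lra.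
  have gut := gd _ _ ut.
  have guts : `|g (u + s) - g (t + s)| < e1 / 24.
    by apply: gd; rewrite (_ : u + s - (t + s) = u - t)//; ring.
  have := ler_distD (g (t + s)) (g (u + s)) (g u).
  have := ler_distD (g t) (g (t + s)) (g u).
  rewrite [`|g t - g u|]distrC opprD addrACA.
  have := lerB_normD (g (t + s) - g t) (f (t + s) - f t).
  by lra.
Qed.
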